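(* There is an absolute constant $c>0$ such that for every Boolean function $f:\{0,1\}^n\to\{0,1\}$, (1) $\mathrm{D}(f)\le c\,\mathrm{alt}(f)\cdot\mathrm{bs}(f)^2$, and (2) $\mathrm{D}(f)\le c\,\mathrm{alt}(f)\cdot\deg(f)^2$. In particular, if $\mathrm{alt}(f)=O(1)$ then $\mathrm{D}(f)=O(\mathrm{bs}(f)^2)$ and $\mathrm{D}(f)=O(\deg(f)^2)$.
   Context: A monotone path from $0^n$ to $1^n$ is a sequence $0^n=x^{(1)},\dots,x^{(k)}=1^n$ where each $x^{(i+1)}$ is obtained from $x^{(i)}$ by changing a single $0$-bit to $1$; its alternation number with respect to $f$ is the number of $i$ with $f(x^{(i)})\ne f(x^{(i+1)})$. $\mathrm{alt}(f)$ is the maximum alternation number of a monotone path from $0^n$ to $1^n$. $\mathrm{D}(f)$ is the minimum depth of a deterministic decision tree (querying single input bits) computing $f$. For $B\subseteq[n]$, $x^{\oplus B}$ is $x$ with bits in $B$ flipped; $B$ is a sensitive block of $x$ if $f(x^{\oplus B})\ne f(x)$; $\mathrm{bs}(f)=\max_x$ (maximum number of pairwise disjoint sensitive blocks of $x$). $\deg(f)$ is the degree of the unique multilinear real polynomial agreeing with $f$ on $\{0,1\}^n$. *)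

(* Defs.v *)
From mathcomp Require Import all_boot all_order all_algebra.
From mathcomp Require Import boolp reals.
From mathcomp Require Import mpoly.

Set Implicit Arguments.
Unset Strict Implicit.
Unset Printing Implicit Defensive.

Import Order.TTheory GRing.Theory Num.Theory.

Definition input (n : nat) := {ffun 'I_n -> bool}.

Definition boolfun (n : nat) := input n -> bool.

Definition zeros n : input n := [ffun _ => false].
Definition ones n : input n := [ffun _ => true].

Definition flip n (x : input n) (B : {set 'I_n}) : input n :=
  [ffun i => x i (+) (i \in B)].

Section Alternation.
Variable n : nat.
Implicit Types (f : boolfun n) (x y : input n) (p : seq (input n)).

Definition mono_step x y := [exists i, ~~ x i && (y == flip x [set i])].

(* [p] lists the vertices that follow the initial vertex [zeros n]. *)
Definition mono_path p :=
  path mono_step (zeros n) p && (last (zeros n) p == ones n).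

Definition alternations f p :=
  count id (pairmap (fun x y => f x != f y) (zeros n) p).

Lemma mono_step_weight x y :
  mono_step x y -> #|[set i | y i]| = #|[set i | x i]|.+1.
Proof.
case/existsP => i /andP[xi /eqP ->].
have -> : [set j | flip x [set i] j] = i |: [set j | x j].
  apply/setP => j; rewrite !inE ffunE !inE.
  by case: (eqVneq j i) => [->|_]; [rewrite (negbTE xi) | rewrite addbF].
by rewrite cardsU1 inE xi.
Qed.

Lemma mono_path_size p : mono_path p -> size p = n.
Proof.
have H x : path mono_step x p ->
    #|[set i | last x p i]| = (#|[set i | x i]| + size p)%N.
  elim: p x => [|y p IH] x /=; first by rewrite addn0.
  by case/andP => /mono_step_weight xy /IH ->; rewrite xy addSnnS.
case/andP => /H {}H /eqP e; move: H; rewrite e.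
have -> : [set i | ones n i] = setT by apply/setP => i; rewrite !inE ffunE.
have -> : [set i | zeros n i] = set0 by apply/setP => i; rewrite !inE ffunE.
by rewrite cardsT card_ord cards0.
Qed.

(* By [mono_path_size], restricting to tuples of length [n] loses no path. *)
Definition alt f := \max_(p : n.-tuple (input n) | mono_path p) alternations f p.

End Alternation.

Section BlockSensitivity.
Variable n : nat.
Implicit Types (f : boolfun n) (x : input n) (B : {set 'I_n}).

Definition sensitive_block f x B := f (flip x B) != f x.

(* The empty block is never sensitive, so a family of pairwise disjoint
   sensitive blocks has no repetitions and is faithfully a set of sets. *)
Definition bs_at f x :=
  \max_(P : {set {set 'I_n}} |
          trivIset P && [forall B in P, sensitive_block f x B]) #|P|.

Definition bs f := \max_(x : input n) bs_at f x.

End BlockSensitivity.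

Section DecisionTree.
Variable n : nat.

Inductive dtree := Leaf of bool | Query of 'I_n & dtree & dtree.

Fixpoint depth (t : dtree) : nat :=
  match t with
  | Leaf _ => 0
  | Query _ t0 t1 => (maxn (depth t0) (depth t1)).+1
  end.

Fixpoint dteval (t : dtree) (x : input n) : bool :=
  match t with
  | Leaf b => b
  | Query i t0 t1 => if x i then dteval t1 x else dteval t0 x
  end.

Definition computes (t : dtree) (f : boolfun n) := forall x, dteval t x = f x.

Definition dtree_depth (f : boolfun n) (d : nat) :=
  exists2 t : dtree, computes t f & depth t = d.

Lemma dtree_exists (f : boolfun n) : exists t, computes t f.
Proof.
suff H (s : seq 'I_n) (y : input n) : exists t,
    forall x : input n, (forall i, i \notin s -> x i = y i) -> dteval t x = f x.
  have [t Ht] := H (enum 'I_n) (zeros n).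
  by exists t => x; apply: Ht => i; rewrite mem_enum.
elim: s y => [|i s IH] y.
  exists (Leaf (f y)) => x Hx /=; congr f.
  by apply/ffunP => i; rewrite Hx.
have [t0 H0] := IH [ffun j => if j == i then false else y j].
have [t1 H1] := IH [ffun j => if j == i then true else y j].
exists (Query i t0 t1) => x Hx /=.
case xi: (x i); [apply: H1|apply: H0] => j js; rewrite ffunE;
  by case: eqVneq => [->//|ji]; apply: Hx; rewrite inE negb_or ji.
Qed.

Lemma dtree_depth_exists (f : boolfun n) : exists d, `[< dtree_depth f d >].
Proof.
have [t Ht] := dtree_exists f.
by exists (depth t); apply/asboolP; exists t.
Qed.

Definition D (f : boolfun n) : nat := ex_minn (dtree_depth_exists f).

End DecisionTree.

Section Degree.
Local Open Scope ring_scope.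
Variables (R : realType) (n : nat).
Implicit Types (f : boolfun n) (p q : {mpoly R[n]}).

Definition multilinear p :=
  all (fun m : 'X_{1..n} => [forall i, (m i <= 1)%N]) (msupp p).

Definition agrees f p :=
  [forall x : input n, p.@[fun i => (x i)%:R] == (f x)%:R].

Lemma multilinearP p :
  reflect (forall m i, p@_m != 0 -> (m i <= 1)%N) (multilinear p).
Proof.
apply: (iffP allP) => [H m i|H m].
  by rewrite -mcoeff_msupp => /H /forallP.
by rewrite mcoeff_msupp => mp; apply/forallP => i; exact: H.
Qed.

Lemma multilinearB p q : multilinear p -> multilinear q -> multilinear (p - q).
Proof.
move=> /multilinearP Hp /multilinearP Hq; apply/multilinearP => m i.
rewrite mcoeffB; have [p0|/Hp //] := eqVneq p@_m 0.
have [q0|/Hq //] := eqVneq q@_m 0.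
by rewrite p0 q0 subr0 eqxx.
Qed.

Lemma multilinear_eq0 p : multilinear p ->
  (forall x : input n, p.@[fun i => (x i)%:R] = 0) -> p = 0.
Proof.
move=> /multilinearP pml p0; apply/eqP; apply: contraT => pN0.
have [m mp mmin] : exists2 m, m \in msupp p &
    forall m', m' \in msupp p -> (mdeg m <= mdeg m')%N.
  have ex : exists d, has (fun m : 'X_{1..n} => mdeg m == d) (msupp p).
    case E: (msupp p) => [|m s].
      by move: pN0; rewrite -msupp_eq0 E.
    by exists (mdeg m); rewrite /= eqxx.
  case: (ex_minnP ex) => d /hasP[m mp /eqP md] dmin.
  exists m => // m' m'p; rewrite md; apply: dmin.
  by apply/hasP; exists m'.
have := p0 [ffun i => m i != 0%N]; rewrite mevalE.
rewrite (bigD1_seq m) ?msupp_uniq //= [X in _ * X]big1 => [|i _]; last first.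
  by rewrite ffunE; case: (m i) => [|k]; rewrite ?expr0 ?expr1n.
rewrite big_seq_cond [X in _ + X]big1 => [|m' /andP[m'p m'm]].
  by rewrite addr0 mulr1 => /eqP; rewrite mcoeff_eq0 mp.
apply/eqP; rewrite mulf_eq0; apply/orP; right; apply: contraT => prodN0.
have le i : (m' i <= m i)%N.
  have := pml m' i; rewrite -mcoeff_msupp => /(_ m'p).
  move: prodN0; rewrite (bigD1 i) //= ffunE mulf_eq0 negb_or => /andP[+ _].
  case: (m i) => [|k] /=; last by move=> _ /leq_trans; apply.
  by case: (m' i) => [//|k]; rewrite expr0n eqxx.
case/eqP: m'm; apply/mnmP => i; apply/eqP; rewrite eqn_leq le /=.
rewrite leqNgt; apply/negP => lt.
have := mmin _ m'p; rewrite !mdegE leqNgt => /negP; apply.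
rewrite (bigD1 i) //= [X in (_ < X)%N](bigD1 i) //= -addSn.
by apply: leq_add => //; apply: leq_sum => j _.
Qed.

Lemma multilinear_agrees_unique f p q :
  multilinear p -> agrees f p -> multilinear q -> agrees f q -> p = q.
Proof.
move=> pml /forallP pf qml /forallP qf; apply/eqP; rewrite -subr_eq0; apply/eqP.
apply: multilinear_eq0 => [|x]; first exact: multilinearB.
by rewrite mevalB (eqP (pf x)) (eqP (qf x)) subrr.
Qed.

Lemma multilinear_agrees_exists f : exists p, multilinear p && agrees f p.
Proof.
pose g (x : input n) i : {mpoly R[n]} := if x i then 'X_i else 1 - 'X_i.
exists (\sum_(x | f x) \prod_i g x i); apply/andP; split.
  apply: (big_ind multilinear) => [|p q /multilinearP Hp /multilinearP Hq|x _].
  - by apply/multilinearP => m i; rewrite mcoeff0 eqxx.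
  - apply/multilinearP => m i; rewrite mcoeffD.
    have [p0|/Hp //] := eqVneq p@_m 0.
    have [q0|/Hq //] := eqVneq q@_m 0.
    by rewrite p0 q0 addr0 eqxx.
  suff H (s : seq 'I_n) : uniq s -> forall m,
      m \in msupp (\prod_(i <- s) g x i) -> forall i, (m i <= (i \in s))%N.
    apply/multilinearP => m i; rewrite -mcoeff_msupp => /H.
    by rewrite index_enum_uniq => /(_ isT i) /leq_trans; apply; case: (_ \in _).
  elim: s => [_ m|j s IH /= /andP[js us] m].
    by rewrite big_nil msupp1 inE => /eqP -> i; rewrite mnm0E.
  rewrite big_cons => /msuppM_le /allpairsP[[a b] /= [ag bs ->]] i.
  rewrite mnmDE inE.
  have Hb := IH us _ bs i.
  have Ha : (a i <= (i == j))%N.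
    have : a \in [:: 0%MM; U_(j)%MM].
      move: ag; rewrite /g; case: (x j); first by rewrite msuppX !inE orbC => ->.
      by move/msuppB_le; rewrite msupp1 msuppX.
    rewrite !inE => /orP[] /eqP ->; first by rewrite mnm0E.
    by rewrite mnm1E eq_sym.
  apply: leq_trans (leq_add Ha Hb) _.
  by case: eqVneq => [->|_]; rewrite ?(negbTE js).
apply/forallP => y; apply/eqP; rewrite raddf_sum /=.
have ev x : (\prod_i g x i).@[fun i => (y i)%:R] = (x == y)%:R.
  rewrite rmorph_prod /=.
  have gE i : (g x i).@[fun i => (y i)%:R] = (x i == y i)%:R.
    rewrite /g; case: (x i); rewrite ?mevalB ?meval1 mevalXU;
      by case: (y i); rewrite /= ?subr0 ?subrr.
  under eq_bigr do rewrite gE.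
  have [->|xy] := eqVneq x y; first by rewrite big1 // => i _; rewrite eqxx.
  have [i xi] : exists i, x i != y i.
    apply/existsP; rewrite -[[exists _, _]]negbK negb_exists; apply: contraNN xy.
    by move=> /forallP H; apply/eqP/ffunP => i; apply/eqP; move: (H i); rewrite negbK.
  by rewrite (bigD1 i) //= (negbTE xi) mul0r.
under eq_bigr do rewrite ev.
case fy: (f y).
  by rewrite (bigD1 y) //= eqxx big1 ?addr0 // => x /andP[_ /negbTE ->].
rewrite big1 // => x fx; case: eqVneq => // xy.
by rewrite xy fy in fx.
Qed.

(* Multilinear real polynomial representing f; unique by
   [multilinear_agrees_unique]. *)
Definition mlpoly f : {mpoly R[n]} := xchoose (multilinear_agrees_exists f).

(* [msize] is one more than the total degree, and 0 for the zero polynomial. *)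
Definition deg f : nat := (msize (mlpoly f)).-1.

End Degree.

Local Open Scope ring_scope.

(* u = O(v) for families over an arbitrary index type, with the bound holding at
   every index; a bound holding only eventually is the case where I is a tail. *)
Definition isbigO (R : realType) (I : Type) (u v : I -> nat) :=
  exists2 C : R, 0 < C & forall i, (u i)%:R <= C * (v i)%:R.

(* Main.v *)
Require Import Defs.
From mathcomp Require Import all_boot all_order all_algebra.
From mathcomp Require Import reals.
From mathcomp Require Import boolp mpoly.

(** Climb from the bottom of a subcube, each time to a minimal point where [f]
    changes value. Each of the at most [alt f] climbs flips at most [K] bits,
    where [K] can be [bs f] or [deg f], because [f] is a point function on the
    interval climbed. At the end [f] is constant above the current point, so
    every subcube has a certificate of size at most [alt f * K]. Querying all
    the variables of a certificate lowers the degree of [f] on the subcube (the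
    certificate meets every monomial of maximal degree), and, if the
    certificate has value [v], lowers by one the block sensitivity on the
    inputs of value [~~ v] (the bits to be corrected to reach the certificate
    form one more sensitive block). This leaves at most [deg f], respectively
    [2 * bs f], rounds. *)

Set Implicit Arguments.
Unset Strict Implicit.
Unset Printing Implicit Defensive.

Import Order.TTheory GRing.Theory Num.Theory.

(** * Flipping sets of bits *)

Section Flip.
Variable n : nat.
Implicit Types (x : input n) (B C : {set 'I_n}).

Lemma flip0 x : flip x set0 = x.
Proof. by apply/ffunP => i; rewrite ffunE inE addbF. Qed.

Lemma flipC x B C : flip (flip x B) C = flip (flip x C) B.
Proof. by apply/ffunP => i; rewrite !ffunE addbAC. Qed.

Lemma flipU1 x i B : i \notin B -> flip (flip x [set i]) B = flip x (i |: B).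
Proof.
move=> iB; apply/ffunP => j; rewrite !ffunE !inE -addbA; congr (_ (+) _).
by case: eqVneq => // ->; rewrite (negbTE iB).
Qed.

Lemma flip_diff x (y : input n) : flip x [set i | x i != y i] = y.
Proof. by apply/ffunP => i; rewrite !ffunE inE; case: (x i); case: (y i). Qed.

Lemma flip_disjoint x B C : [disjoint B & C] -> {in C, flip x B =1 x}.
Proof.
by move=> BC i iC; rewrite ffunE (disjointFl BC iC) addbF.
Qed.

End Flip.

(** * Monotone climbs and small certificates *)

Section Climbing.
Variables (n : nat) (f : boolfun n).
Implicit Types (x y z u v w a : input n) (p : seq (input n)) (S T : {set 'I_n}).

Definition below x y := forall i, x i -> y i.

Lemma below_path x y : below x y ->
  exists2 p, path (@mono_step n) x p & last x p = y.
Proof.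
move: {2}#|_| (erefl #|[set i | y i && ~~ x i]|) => m.
elim: m x => [|m IH] x card_m xy.
  exists [::] => //; apply/ffunP => i /=.
  move/eqP: card_m; rewrite cards_eq0 => /eqP/setP/(_ i); rewrite !inE.
  by have := xy i; case: (x i) => [->|_] //; case: (y i).
have /card_gt0P[i] : (0 < #|[set i | y i && ~~ x i]|)%N by rewrite card_m.
rewrite inE => /andP[yi xi].
have [|j|p xp pl] := IH (flip x [set i]).
- move: card_m; rewrite (cardsD1 i) inE yi xi => -[<-]; apply: eq_card => j.
  rewrite !inE ffunE inE; case: (eqVneq j i) => [->|_] /=; last by rewrite addbF.
  by rewrite (negbTE xi) andbF.
- by rewrite ffunE inE; case: eqVneq => [->//|_]; rewrite addbF; apply: xy.
exists (flip x [set i] :: p) => //=; rewrite xp andbT.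
by apply/existsP; exists i; rewrite xi eqxx.
Qed.

Lemma alternations_ge x p :
  ((f x != f (last x p)) <=
     count id (pairmap (fun x y => f x != f y) x p))%N.
Proof.
elim: p x => [|y p IH] x /=; first by rewrite eqxx.
apply: leq_trans _ (leq_add (leqnn _) (IH y)).
by case: (f x); case: (f y); case: (f _).
Qed.

(** A lower bound suffices: a segment appended to the path may contain more alternations than its
    endpoints reveal. *)
Definition climb k z := exists p,
  [/\ path (@mono_step n) (zeros n) p, last (zeros n) p = z
    & (k <= alternations f p)%N].

Lemma climb_step k x y : climb k x -> below x y ->
  climb (k + (f x != f y)) y.
Proof.
move=> [p [p0 pl pk]] /below_path[q xq ql]; exists (p ++ q); split.
- by rewrite cat_path p0 pl.
- by rewrite last_cat pl.
rewrite /alternations pairmap_cat count_cat pl -ql.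
exact: leq_add pk (alternations_ge _ _).
Qed.

Lemma climb0 x : climb 0 x.
Proof.
have [|p p0 pl] := @below_path (zeros n) x; last by exists p.
by move=> i; rewrite ffunE.
Qed.

Lemma climb_le_alt k x : climb k x -> (k <= alt f)%N.
Proof.
move=> kx; have [|p [p0 pl pk]] := @climb_step _ _ (ones n) kx.
  by move=> i; rewrite ffunE.
have pm : Defs.mono_path p by rewrite /Defs.mono_path p0 pl eqxx.
apply: leq_trans (leq_trans (leq_addr _ _) pk) _.
have sp := introT eqP (mono_path_size pm).
exact: (@leq_bigmax_cond _ (fun t : n.-tuple _ => Defs.mono_path t)
          (fun t => alternations f t) (Tuple sp)).
Qed.

Definition first_change u v := [/\ below u v, f v != f u
  & forall w, below u w -> below w v -> w != v -> f w = f u].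

Variable K : nat.
Hypothesis change_le : forall u v, first_change u v ->
  (#|[set i | v i && ~~ u i]| <= K)%N.

(** The current point [z] is 0 outside [S :|: T z], hence the least point of the subcube it fixes.
    If [f] is not constant there, a climb to a first change adds one alternation and at most [K]
    positions to [T z]; [alt f] caps the number of climbs. *)
Lemma small_certificate S a : exists z T,
  [/\ {in S, z =1 a}, [disjoint T & S], (#|T| <= alt f * K)%N
    & forall x, {in S :|: T, x =1 z} -> f x = f z].
Proof.
pose T z := [set i | z i] :\: S.
suff H k z : climb k z -> {in S, z =1 a} -> (#|T z| <= k * K)%N ->
    exists z, [/\ {in S, z =1 a}, (#|T z| <= alt f * K)%N
      & forall x, {in S :|: T z, x =1 z} -> f x = f z].
  have [|i iS||z [za zK zf]] := H 0 [ffun i => (i \in S) && a i].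
  - exact: climb0.
  - by rewrite ffunE iS.
  - rewrite eq_card0 // => i; rewrite !inE ffunE.
    by case: (i \in S).
  by exists z, (T z); split=> //; rewrite -setI_eq0 setIDAC setDIl setDv setI0.
have [m] := ubnP (alt f - k); elim: m k z => // m IH k z le_m kz zS zk.
have k_alt := climb_le_alt kz.
case: (pselect (forall x, {in S :|: T z, x =1 z} -> f x = f z)) => [zf|nconst].
  by exists z; split=> //; apply: leq_trans zk _; rewrite leq_mul2r k_alt orbT.
pose off x := [forall i in S :|: T z, x i == z i] && (f x != f z).
have [x0 x0P] : exists x, off x.
  apply: contrapT => none; apply: nconst => x xz; apply/eqP.
  apply: contraT => fx; case: none; exists x; rewrite /off fx andbT.
  by apply/forall_inP => i iz; rewrite xz.
(* Minimal weight is enough for [first_change]: any other point between [z] and [x] is lighter than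
   [x] and still agrees with [z] on [S :|: T z]. *)
case: (@arg_minnP _ x0 off (fun x => #|[set i | x i]|) x0P) => x.
move=> /andP[/forall_inP xz fx] xmin.
have zx : below z x.
  move=> i zi; rewrite (eqP (xz i _)) // !inE zi andbT.
  exact: orbN.
have := climb_step kz zx; rewrite eq_sym fx addn1 => kx.
have change : first_change z x.
  split=> // w zw wx wNx; apply/eqP; apply: contraT => fw.
  suff : (#|[set i | w i]| < #|[set i | x i]|)%N.
    rewrite ltnNge xmin // /off fw andbT; apply/forall_inP => i iz.
    move: (xz i iz) => /eqP xzi.
    by apply/eqP; apply/idP/idP => [/wx|/zw //]; rewrite xzi.
  apply: proper_card; rewrite properE; apply/andP; split.
    by apply/subsetP => i; rewrite !inE; apply: wx.
  apply: contra wNx => /subsetP xw; apply/eqP/ffunP => i; apply/idP/idP.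
    exact: wx.
  by have := xw i; rewrite !inE.
apply: (IH k.+1 x) => //.
(* The truncated [alt f - k] really decreases, since the longer climb to [x] shows [k < alt f]. *)
- by rewrite -ltnS; apply: leq_trans _ le_m; rewrite ltnS ltn_sub2l // (climb_le_alt kx).
- by move=> i iS; rewrite -zS // (eqP (xz i _)) // inE iS.
rewrite mulSn addnC; apply: leq_trans _ (leq_add zk (change_le change)).
rewrite -cardsUI; apply: leq_trans _ (leq_addr _ _).
apply/subset_leq_card/subsetP => i; rewrite !inE => /andP[-> ->] /=.
by rewrite orbN.
Qed.

End Climbing.

(** * Decision trees built in rounds *)

Section Querying.
Variables (n : nat) (f : boolfun n).
Implicit Types (x a b : input n) (S T : {set 'I_n}) (t : dtree n).

Definition tree_on S a d := exists2 t, (depth t <= d)%N &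
  forall x, {in S, x =1 a} -> dteval t x = f x.

Lemma query_seq d (s : seq 'I_n) S a :
  (forall b, {in S, b =1 a} -> tree_on (S :|: [set:: s]) b d) ->
  tree_on S a (size s + d).
Proof.
elim: s S a => [|i s IH] S a Hb.
  have [//|t td tf] := Hb a; exists t => // x xS; apply: tf => j.
  by rewrite !inE orbF; apply: xS.
have Hi v : exists2 t, (depth t <= size s + d)%N &
    forall x, {in S, x =1 a} -> x i = v -> dteval t x = f x.
  case: (pselect (exists x, {in S, x =1 a} /\ x i = v)) => [[c [cS ci]]|nx].
    have [b bc|t td tf] := IH (i |: S) c.
      rewrite -setUA setUC -setUA [_ :|: [set i]]setUC -set_cons.
      by apply: Hb => j jS; rewrite bc ?cS // !inE jS orbT.
    exists t => // x xS xi; apply: tf => j; rewrite !inE.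
    by case: eqVneq => [-> _|_ /= jS]; rewrite ?xi ?ci ?xS ?cS.
  (* No input of the subcube has value [v] at [i], so the leaf is arbitrary. *)
  exists (Leaf _ true) => // x xS xi.
  by case: nx; exists x.
have [t0 d0 H0] := Hi false; have [t1 d1 H1] := Hi true.
exists (Query i t0 t1); first by rewrite /= addSn ltnS geq_max d0.
by move=> x xS /=; case xi: (x i); [apply: H1|apply: H0].
Qed.

Lemma query_set d T S a :
  (forall b, {in S, b =1 a} -> tree_on (S :|: T) b d) ->
  tree_on S a (#|T| + d).
Proof.
move=> Hb; rewrite cardE; apply: query_seq => b /Hb.
suff -> : [set:: enum T] = T by [].
by apply/setP => i; rewrite inE mem_enum.
Qed.

Lemma tree_on_le S a d e : (d <= e)%N -> tree_on S a d -> tree_on S a e.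
Proof. by move=> de [t td tf]; exists t => //; apply: leq_trans td de. Qed.

Definition const_on S a := forall x, {in S, x =1 a} -> f x = f a.

Variables (K : nat) (Phi : nat -> {set 'I_n} -> input n -> Prop).
Hypothesis round : forall m S a, Phi m S a -> ~ const_on S a ->
  exists2 T : {set 'I_n}, (#|T| <= K)%N & exists2 m', m = m'.+1 &
    forall b, {in S, b =1 a} -> Phi m' (S :|: T) b.

(** [Phi m S a] acts as a potential: a round costs at most [K] queries and lowers [m] by one
    whatever the answers. At [m = 0], [round] would need [0 = m'.+1], so [f] is already constant on
    the subcube. *)
Lemma rounds m S a : Phi m S a -> tree_on S a (m * K).
Proof.
elim: m S a => [|m IH] S a Pa.
all: case: (pselect (const_on S a)) => [Sa|].
all: try by exists (Leaf _ (f a)) => // x xS; rewrite Sa.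
all: case/(round Pa) => T TK [// m' [<-]] Hb.
apply: (@tree_on_le _ _ (#|T| + m * K)); first by rewrite mulSn leq_add2r.
by apply: query_set => b /Hb; apply: IH.
Qed.

Lemma D_le_rounds m : Phi m set0 (zeros n) -> (D f <= m * K)%N.
Proof.
move=> /rounds[t td tf]; apply: leq_trans _ td.
rewrite /D; case: ex_minnP => d _; apply; apply/asboolP; exists t => // x.
by apply: tf => i; rewrite inE.
Qed.

End Querying.

(** * The bound by block sensitivity *)

Section BlockBound.
Variables (n : nat) (f : boolfun n).
Implicit Types (x y z a b : input n) (S T B : {set 'I_n}) (P : {set {set 'I_n}}).

Lemma card_blocks_le y P : trivIset P ->
  (forall B, B \in P -> sensitive_block f y B) -> (#|P| <= bs f)%N.
Proof.
move=> tP sP; apply: leq_trans _ (leq_bigmax y).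
apply: (@leq_bigmax_cond _ _ (fun P : {set {set 'I_n}} => #|P|)).
by rewrite tP; apply/forall_inP.
Qed.

(** Turning off at [v] any single bit that [u] lacks stays in the interval, where [f] takes the
    value [f u]; these singletons are disjoint sensitive blocks of [v]. *)
Lemma first_change_bs u v : first_change f u v ->
  (#|[set i | v i && ~~ u i]| <= bs f)%N.
Proof.
move=> [uv fv fuv]; rewrite -(card_imset _ (@set1_inj 'I_n)).
apply: (@card_blocks_le v).
  apply/trivIsetP => _ _ /imsetP[i _ ->] /imsetP[j _ ->] ij.
  by rewrite disjoints1 inE; apply: contra ij => /eqP ->.
move=> _ /imsetP[i + ->]; rewrite inE => /andP[vi ui].
rewrite /sensitive_block fuv 1?eq_sym //.
- move=> j uj; rewrite ffunE inE uv //.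
  by case: eqVneq => // ji; rewrite -ji uj in ui.
- by move=> j; rewrite ffunE inE; case: eqVneq => [->//|_]; rewrite addbF.
- by apply/eqP => /ffunP/(_ i); rewrite ffunE inE eqxx addbT; case: (v i).
Qed.

Definition block_family S a (v : bool) y P :=
  [/\ {in S, y =1 a}, f y = v, trivIset P
  & forall B, B \in P -> sensitive_block f y B /\ [disjoint B & S]].

(** One bound per output value: a certificate is only sure to lower the bound for the value opposite
    to its own, so the potential is the sum. *)
Definition block_bound m S a := exists2 mb : bool -> nat,
  (mb false + mb true = m)%N &
  forall v y P, block_family S a v y P -> (#|P| <= mb v)%N.

(** The extra block is the set of positions of [T] where [y] differs from [z]: flipping it makes [y]
    meet the certificate. It is disjoint from the old blocks, which avoid [S :|: T]. *)
Lemma block_family_extend S T a b y z P :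
  {in S, z =1 a} -> {in S, b =1 a} -> [disjoint T & S] ->
  (forall x, {in S :|: T, x =1 z} -> f x = f z) ->
  block_family (S :|: T) b (~~ f z) y P ->
  exists2 Q, block_family S a (~~ f z) y Q & #|Q| = #|P|.+1.
Proof.
move=> za ba TS zT [yb fy tP HP].
have yS : {in S, y =1 a} by move=> i iS; rewrite yb ?ba // inE iS.
pose B := [set i in T | y i != z i].
have BT : B \subset T by apply/subsetP => i; rewrite inE => /andP[].
have sB : sensitive_block f y B.
  rewrite /sensitive_block zT ?fy; first by case: (f z).
  move=> i; rewrite ffunE !inE; case: (boolP (i \in T)) => [_ _|iT] /=.
    by case: (y i); case: (z i).
  by rewrite orbF addbF => iS; rewrite yS // za.
have dB C : C \in P -> [disjoint B & C].
  case/HP=> _; rewrite disjoint_sym => dC.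
  by apply: disjointWl _ dC; apply: subset_trans BT (subsetUr _ _).
have BP : B \notin P.
  apply/negP => /dB; rewrite -setI_eq0 setIid => /eqP B0.
  by move: sB; rewrite B0 /sensitive_block flip0 eqxx.
exists (B |: P); last by rewrite cardsU1 BP.
split=> //.
  apply/trivIsetP => C C'; rewrite !inE.
  move=> /orP[/eqP->|CP] /orP[/eqP->|C'P] CC'.
  - by rewrite eqxx in CC'.
  - exact: dB.
  - by rewrite disjoint_sym dB.
  - exact: (trivIsetP tP).
move=> C; rewrite inE => /orP[|/HP[sC dC]].
  by rewrite inE => /eqP->; split=> //; apply: disjointWl BT TS.
by split=> //; apply: disjointWr _ dC; apply: subsetUl.
Qed.

Lemma block_round m S a : block_bound m S a -> ~ const_on f S a ->
  exists2 T : {set 'I_n}, (#|T| <= alt f * bs f)%N & exists2 m', m = m'.+1 &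
    forall b, {in S, b =1 a} -> block_bound m' (S :|: T) b.
Proof.
move=> [mb mE Hmb] nconst.
have [z [T [za TS TK zT]]] := small_certificate first_change_bs S a.
exists T => //; pose v := ~~ f z.
have lt b y P : {in S, b =1 a} -> block_family (S :|: T) b v y P ->
    (#|P| < mb v)%N.
  by move=> ba /(block_family_extend za ba TS zT)[Q /Hmb + <-].
(* Non-constancy gives an input of value [v] in the subcube, and its empty family extends to one
   block. *)
have v_gt0 : (0 < mb v)%N.
  have [y yS fy] : exists2 y : input n, {in S, y =1 a} & f y = v.
    apply: contrapT => none; apply: nconst.
    suff fz (x : input n) : {in S, x =1 a} -> f x = f z by move=> x xS; rewrite !fz.
    move=> xS; apply/eqP; apply: contraT => fx; case: none; exists x => //.
    by move: fx; rewrite /v; case: (f x); case: (f z).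
  rewrite -(cards0 {set 'I_n}); apply: (lt y y _ yS); split=> // [|B].
    by apply/trivIsetP => B C; rewrite inE.
  by rewrite inE.
exists m.-1.
  by rewrite prednK // -mE; case: (v) v_gt0; rewrite addn_gt0 => ->; rewrite ?orbT.
move=> b ba; exists (fun c => mb c - (c == v))%N.
  rewrite -mE; case: (v) v_gt0 => /=; rewrite subn0 subn1.
    by case: (mb true) => // k _; rewrite addnS.
  by case: (mb false).
move=> c y P yP; case: eqVneq => [cv|_]; rewrite ?subn0 ?subn1.
  by rewrite cv -ltnS prednK //; apply: (lt b y); rewrite // -cv.
case: yP => yb fy tP HP; apply: (Hmb c y); split=> // [i iS|B /HP[sB dB]].
  by rewrite yb ?ba // inE iS.
by split=> //; apply: disjointWr _ dB; apply: subsetUl.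
Qed.

Lemma D_le_alt_bs : (D f <= (bs f + bs f) * (alt f * bs f))%N.
Proof.
(* Both output values start with the bound [bs f]. *)
apply: (D_le_rounds block_round); exists (fun=> bs f) => // b y P [_ _ tP HP].
by apply: (card_blocks_le (y := y) tP) => B /HP[].
Qed.

End BlockBound.

(** * Iterated differences and degree *)

Section Differences.
Local Open Scope ring_scope.
Variables (R : realType) (n : nat).
Implicit Types (F G : input n -> R) (x y : input n) (s : seq 'I_n).

(** A discrete derivative of order [size s]: for duplicate-free [s], the sum over [B] included in
    [s] of [(-1)^#|B| * F (flip x B)]. *)
Fixpoint diff s F x : R :=
  if s is i :: s' then diff s' F x - diff s' F (flip x [set i]) else F x.

Lemma diff_const s F x c :
  (forall B : {set 'I_n}, B \subset s -> F (flip x B) = c) ->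
  diff s F x = (s == [::])%:R * c.
Proof.
elim: s x => [|i s IH] x Hc /=.
  by rewrite -(flip0 x) Hc ?mul1r //; apply/subsetP => j; rewrite inE.
rewrite !IH ?subrr ?mul0r // => B Bs; last first.
  by apply: Hc; apply: subset_trans Bs _; apply/subsetP => j; rewrite inE orbC => ->.
case: (boolP (i \in B)) => iB; last first.
  rewrite flipU1 //; apply: Hc; apply/subsetP => j; rewrite !inE.
  by case: eqVneq => //= _ /(subsetP Bs).
(* Here [s] repeats [i], and the two flips of [i] cancel. *)
rewrite -(setD1K iB) -flipU1 ?setD11 //.
have -> : flip (flip x [set i]) [set i] = x.
  by apply/ffunP => j; rewrite !ffunE addbK.
apply: Hc; apply/subsetP => j; rewrite !inE => /andP[_ /(subsetP Bs) ->].
exact: orbT.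
Qed.

(** Only the term of the empty [B] can deviate from [c], and the alternating sum of a constant over
    a nonempty [s] is 0. *)
Lemma diff_point s F x c : uniq s ->
  (forall B : {set 'I_n}, B \subset s -> B != set0 -> F (flip x B) = c) ->
  s != [::] -> diff s F x = F x - c.
Proof.
elim: s => // i s IH /= /andP[ins us] Hc _.
have subs (B : {set 'I_n}) : B \subset s -> B \subset i :: s.
  by move/subset_trans; apply; apply/subsetP => j; rewrite inE orbC => ->.
rewrite (@diff_const s F (flip x [set i]) c) => [|B Bs].
  case: s IH ins us Hc subs => [|j s] IH ins us Hc subs.
    by rewrite mul1r.
  by rewrite IH ?mul0r ?subr0 // => B /subs; apply: Hc.
rewrite flipU1; last by apply: contra ins => /(subsetP Bs).
apply: Hc; last by apply/set0Pn; exists i; rewrite setU11.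
apply/subsetP => j; rewrite !inE.
by case: eqVneq => //= _ /(subsetP Bs).
Qed.

Lemma diff_invariant i s F x : (forall y, F (flip y [set i]) = F y) ->
  diff s F (flip x [set i]) = diff s F x.
Proof.
move=> Fi; elim: s x => [|j s IH] x /=; first exact: Fi.
by rewrite flipC !IH.
Qed.

Lemma diff_invariant0 i s F x : (forall y, F (flip y [set i]) = F y) ->
  i \in s -> diff s F x = 0.
Proof.
move=> Fi; elim: s x => // j s IH x; rewrite inE.
case: eqVneq => [<- _|_ /= si] /=; first by rewrite diff_invariant // subrr.
by rewrite !IH // subrr.
Qed.

Lemma eq_diff s F G : F =1 G -> diff s F =1 diff s G.
Proof. by move=> FG; elim: s => // i s IH x /=; rewrite !IH. Qed.

Lemma diff_sum (I : Type) (r : seq I) (c : I -> R) (F : I -> input n -> R) s x :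
  diff s (fun y => \sum_(k <- r) c k * F k y) x
  = \sum_(k <- r) c k * diff s (F k) x.
Proof.
elim: s x => // i s IH x /=; rewrite !IH -sumrB.
by apply: eq_bigr => k _; rewrite mulrBr.
Qed.

(** A monomial of degree below [size s] misses some variable of [s], and the difference in that
    direction kills it. *)
Lemma diff_deg (f : boolfun n) s x : uniq s -> (deg R f < size s)%N ->
  diff s (fun y => (f y)%:R) x = 0.
Proof.
move=> us sd; pose p := mlpoly R f.
have /andP[_ /forallP pf] : multilinear p && agrees f p.
  exact: xchooseP (multilinear_agrees_exists R f).
rewrite (@eq_diff _ _ (fun y =>
  \sum_(m <- msupp p) p@_m * \prod_i (y i)%:R ^+ m i)); last first.
  by move=> y; rewrite -mevalE; apply/esym/eqP/pf.
rewrite diff_sum big_seq big1 // => m mp.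
have ms : (mdeg m < size s)%N.
  apply: leq_ltn_trans _ sd; rewrite /deg -ltnS.
  have := msize_mdeg_lt mp; rewrite -/p.
  by case: (msize p).
have [i si mi] : exists2 i, i \in s & m i = 0%N.
  apply: contrapT => mN0; move: ms; rewrite ltnNge => /negP; apply.
  rewrite mdegE (bigID (fun i => i \in s)) /= -(big_uniq _ us) -sum1_size /=.
  apply: leq_trans _ (leq_addr _ _); rewrite big_seq [X in (_ <= X)%N]big_seq.
  apply: leq_sum => i si; rewrite lt0n; apply: contra_notN mN0 => /eqP mi.
  by exists i.
rewrite (@diff_invariant0 i) ?mulr0 // => y; apply: eq_bigr => j _.
by rewrite ffunE inE; case: eqVneq => [->|_]; rewrite ?mi ?expr0 ?addbF.
Qed.

End Differences.

(** * The bound by degree *)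

Section DegreeBound.
Variables (R : realType) (n : nat) (f : boolfun n).
Implicit Types (x y z a b : input n) (S T B : {set 'I_n}) (s : seq 'I_n).

Let fR : input n -> R := fun y => (f y)%:R%R.

(** At [v], the difference along the bits that [u] lacks is [f v - f u], which is nonzero, so its
    order cannot exceed the degree. *)
Lemma first_change_deg u v : first_change f u v ->
  (#|[set i | v i && ~~ u i]| <= deg R f)%N.
Proof.
move=> [uv fv fuv]; set W := [set i | _]; rewrite leqNgt; apply/negP => Wd.
have := @diff_deg R n f (enum W) v (enum_uniq _).
rewrite -cardE (@diff_point _ _ _ _ _ (fR u)) ?enum_uniq //.
- move=> /(_ Wd)/eqP; rewrite subr_eq0 eqr_nat; apply/negP.
  by move: fv; rewrite /fR; case: (f u); case: (f v).
- move=> B BW BN0; rewrite /fR fuv //.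
  + move=> i ui; rewrite ffunE uv //; case: (boolP (i \in B)) => // /(subsetP BW).
    by rewrite mem_enum inE ui andbF.
  + move=> i; rewrite ffunE; case: (boolP (i \in B)) => [|_]; last by rewrite addbF.
    by move/(subsetP BW); rewrite mem_enum inE => /andP[->].
  + case/set0Pn: BN0 => i iB; apply/eqP => /ffunP/(_ i); rewrite ffunE iB.
    by case: (v i).
- by rewrite -size_eq0 -cardE -lt0n; apply: leq_ltn_trans _ Wd.
Qed.

(** Encodes that [f] restricted to the subcube has degree at most [m], through vanishing differences
    instead of a restricted polynomial. *)
Definition deg_bound m S a := forall s, uniq s -> [disjoint s & S] ->
  (m < size s)%N -> forall y, {in S, y =1 a} -> diff s fR y = 0%R.

(** A difference along at least [m] variables outside [S :|: T] is unchanged when [y] is moved onto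
    the certificate, where [f] is constant; so it vanishes. *)
Lemma deg_round m S a : deg_bound m S a -> ~ const_on f S a ->
  exists2 T : {set 'I_n}, (#|T| <= alt f * deg R f)%N & exists2 m', m = m'.+1 &
    forall b, {in S, b =1 a} -> deg_bound m' (S :|: T) b.
Proof.
move=> Hm nconst.
have [z [T [za TS TK zT]]] := small_certificate first_change_deg S a.
(* Flipping one more variable [i] changes the value by the difference along [i :: s], whose order
   exceeds [m]. *)
have diff_flip s r y : uniq s -> (m <= size s)%N -> [disjoint s & S] ->
    uniq r -> [disjoint r & s] -> [disjoint r & S] -> {in S, y =1 a} ->
    diff s fR (flip y [set:: r]) = diff s fR y.
  move=> us ms sS; elim: r y => [|i r IH] y; first by rewrite set_nil flip0.
  rewrite /= => /andP[ir ur]; rewrite !disjoint_cons.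
  move=> /andP[si rs] /andP[iS rS] yS.
  rewrite set_cons -flipU1 ?inE // IH //.
    apply/esym/eqP; rewrite -subr_eq0; apply/eqP.
    by apply: (Hm (i :: s)) => //=; rewrite ?si ?disjoint_cons ?iS.
  by move=> j jS; rewrite (@flip_disjoint _ _ _ S) ?yS // disjoints1.
(* If [m = 0], [diff_flip] with empty [s] makes [f] constant on the subcube. *)
have m_gt0 : (0 < m)%N.
  rewrite lt0n; apply/eqP => m0; apply: nconst => x xS.
  have := diff_flip [::] (enum [set i | a i != x i]) a.
  rewrite m0 disjoint0 enum_uniq /=.
  have -> : [set:: enum [set i | a i != x i]] = [set i | a i != x i].
    by apply/setP => i; rewrite inE mem_enum.
  rewrite flip_diff => fxa; have {fxa} : fR x = fR a.
    apply: fxa => //; first by rewrite disjoint_sym disjoint0.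
    rewrite disjoint_subset; apply/subsetP => i; rewrite mem_enum !inE.
    by apply: contra => /xS ->.
  by move/eqP; rewrite eqr_nat; case: (f x); case: (f a).
exists T => //; exists m.-1; first by rewrite prednK.
move=> b ba s us sST; rewrite prednK // => ms y yb.
have yS : {in S, y =1 a} by move=> i iS; rewrite yb ?ba // inE iS.
have sS : [disjoint s & S] by apply: disjointWr _ sST; apply: subsetUl.
pose C := [set i in T | y i != z i].
have CT : C \subset T by apply/subsetP => i; rewrite inE => /andP[].
have CE : [set:: enum C] = C by apply/setP => i; rewrite inE mem_enum.
rewrite -(diff_flip s (enum C)) ?enum_uniq // ?CE; last 2 first.
- rewrite disjoint_sym; apply: disjointWr _ sST.
  by apply/subsetP => i; rewrite mem_enum => /(subsetP CT) iT; rewrite inE iT orbT.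
- apply: disjointWl _ TS; apply/subsetP => i; rewrite mem_enum.
  exact: (subsetP CT).
rewrite (@diff_const _ _ _ _ _ (fR z)) => [|B Bs].
  (* Positivity of [m] makes [s] nonempty, so the difference of a constant is 0. *)
  case: (s) ms m_gt0 => [|i s' _ _]; last by rewrite mul0r.
  by case: (m).
rewrite /fR zT // => i iST; rewrite (@flip_disjoint _ _ _ (S :|: T)) //; last first.
  by exact: disjointWl Bs sST.
move: iST; rewrite ffunE !inE; case: (boolP (i \in T)) => [_ _|iT] /=.
  by case: (y i); case: (z i).
by rewrite orbF addbF => iS; rewrite yS // za.
Qed.

Lemma D_le_alt_deg : (D f <= deg R f * (alt f * deg R f))%N.
Proof.
apply: (D_le_rounds deg_round) => s us _ sd y _.
exact: diff_deg.
Qed.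

End DegreeBound.

(** * Both bounds with a common constant *)

Local Open Scope ring_scope.

Theorem theorem3 (R : realType) :
  (exists2 c : R, 0 < c &
     forall (n : nat) (f : boolfun n),
       (D f)%:R <= c * (alt f)%:R * (bs f)%:R ^+ 2 /\
       (D f)%:R <= c * (alt f)%:R * (deg R f)%:R ^+ 2) /\
  (forall (I : Type) (n : I -> nat) (f : forall i : I, boolfun (n i)),
     isbigO R (fun i => alt (f i)) (fun _ => 1%N) ->
     isbigO R (fun i => D (f i)) (fun i => (bs (f i) ^ 2)%N) /\
     isbigO R (fun i => D (f i)) (fun i => (deg R (f i) ^ 2)%N)).
Proof.
have bsP n (f : boolfun n) : (D f)%:R <= 2 * (alt f)%:R * (bs f)%:R ^+ 2 :> R.
  rewrite -natrX -!natrM ler_nat; apply: leq_trans (D_le_alt_bs f) _.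
  by rewrite addnn -mul2n -!mulnA leq_mul2l /= mulnCA.
have degP n (f : boolfun n) :
    (D f)%:R <= 2 * (alt f)%:R * (deg R f)%:R ^+ 2 :> R.
  rewrite -natrX -!natrM ler_nat; apply: leq_trans (D_le_alt_deg R f) _.
  (* The degree bound even holds with constant 1; the 2 comes from the two output values in the
     other bound. *)
  by rewrite mulnCA -mulnA mulnn leq_pmull.
split; first by exists 2.
move=> I n f [C C0 altC].
have C2 : 0 < 2 * C by rewrite mulr_gt0.
have altM i d : 2 * (alt (f i))%:R * d%:R ^+ 2 <= 2 * C * (d ^ 2)%N%:R.
  by rewrite natrX ler_wpM2r ?exprn_ge0 // ler_pM2l // -[C]mulr1.
split; exists (2 * C) => // i; apply: le_trans (altM i _).
  exact: bsP.
exact: degP.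
Qed.
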